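(* Let $(X,d,A)$ be a metric pair such that $(X/A,d_1,[A])$ is separable and not uniformly discrete, let $B=\widehat V(X,A)$, let $(J,\Sigma)$ be admissible covariance data on $B$ built from a norming sequence $(\ell_n)$, weights $(w_n)$ and eigenvalues $(\sigma_n)$, and let $t>0$. Let $H_{J,\Sigma,t}$ be the reproducing kernel Hilbert space of the kernel $k_{J,\Sigma,t}$ on $B$. For every $f\in H_{J,\Sigma,t}$, $$\mathrm{Lip}_{\rho}\bigl(f|_{K(X,A)}\bigr)\le\sqrt t\,\Bigl(\sum_{n\ge1}\sigma_nw_n^2\Bigr)^{1/2}\,\|f\|_{H_{J,\Sigma,t}}.$$
   Context: A metric pair $(X,d,A)$ is a metric space with a distinguished subset $A\subseteq X$. Put $d(x,A):=\inf_{a\in A}d(x,a)$ and $d_1(x,y):=\min\bigl(d(x,y),\,d(x,A)+d(y,A)\bigr)$. Let $X/A$ be the quotient collapsing $A$ to a point $[A]$; $d_1$ descends to $X/A$. Standing assumption: $A$ is nonempty and $d_1$ is a genuine metric on $X/A$ (i.e. $d(x,A)>0$ for $x\notin A$). A metric space is uniformly discrete if distances between distinct points are bounded below by some $\varepsilon>0$. $D(X,A):=D(X)/D(A)$, where $D(Y)$ is the free commutative monoid on $Y$. For $\alpha,\beta\in D(X,A)$, $W_1(\alpha,\beta):=\inf_\sigma\sum_{(x,y)\in\sigma}d_1(x,y)$ over $\sigma\in D(X\times X)$ whose marginals agree with $\alpha,\beta$ modulo $D(A)$. $K(X,A)$ is the Grothendieck group of $D(X,A)$ with translation-invariant metric $\rho(\alpha-\beta,\gamma-\delta):=W_1(\alpha+\delta,\gamma+\beta)$.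 It is the free abelian group with basis $(e_u)_{u\in X/A\setminus\{[A]\}}$. $V(X,A)=V(X)/V(A)$ ($V(Y)$ the free real vector space on $Y$) has basis $(e_u)_{u\in X/A\setminus\{[A]\}}$ and norm $\|\sum_uc_ue_u\|_{W_1}=\sup\{\sum_uc_uf(u): f\colon X/A\to\mathbb R,\ f([A])=0,\ \mathrm{Lip}_{d_1}(f)\le1\}$. $B=\widehat V(X,A)$ is its Banach completion (the Lipschitz-free space $\mathcal F(X/A,d_1)$). $K(X,A)\subset V(X,A)\subset B$ canonically, and $\rho(g,h)=\|g-h\|_{W_1}$ for $g,h\in K(X,A)$; $f|_{K(X,A)}$ is restriction along this embedding. Admissible covariance data $(J,\Sigma)$: fix a sequence $(\ell_n)_{n\ge1}\subset B^\ast$ with $\|\ell_n\|_{B^\ast}\le1$ that is norming ($\|x\|_{W_1}=\sup_n|\ell_n(x)|$ for all $x\in B$) and a strictly positive $(w_n)\in\ell^2$; $J\colon B\to\ell^2$, $Jx:=(w_n\ell_n(x))_n$. $\Sigma$ is the positive trace-class operator on $\ell^2$ with $\Sigma e_n=\sigma_ne_n$ in the standard basis, $\sigma_n\ge0$, $\sum_n\sigma_n<\infty$. For $t>0$, $k_{J,\Sigma,t}(x,y):=\exp\bigl(-\tfrac t2\|\Sigma^{1/2}J(x-y)\|_{\ell^2}^2\bigr)$ for $x,y\in B$, a positive definite kernel on $B$; $H_{J,\Sigma,t}$ is its (real) reproducing kernel Hilbert space of functions on $B$. For $f\colon K(X,A)\to\mathbb R$, $\mathrm{Lip}_\rho(f):=\sup_{\alpha\ne\beta}|f(\alpha)-f(\beta)|/\rho(\alpha,\beta)\in[0,\infty]$.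 *)

(* Defs.v *)
From HB Require Import structures.
From mathcomp Require Import all_boot all_order all_algebra.
From mathcomp Require Import generic_quotient finmap multiset.
From mathcomp Require Import all_classical all_reals all_analysis.
From mathcomp Require Import freeg lra.

Set Implicit Arguments.
Unset Strict Implicit.
Unset Printing Implicit Defensive.

Import Order.TTheory GRing.Theory Num.Theory.
Import numFieldNormedType.Exports.

Local Open Scope classical_set_scope.
Local Open Scope quotient_scope.
Local Open Scope mset_scope.
Local Open Scope ring_scope.

Section MetricPair.
Variables (R : realType) (X : metricType R).

Definition dist_to (A : set X) (x : X) : R :=
  inf [set mdist x a | a in A].

Record metric_pair := MetricPair {
  mp_set : set X ;
  mp_nonempty : mp_set !=set0 ;
  mp_dist_gt0 : forall x, ~ mp_set x -> 0 < dist_to mp_set x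
}.

Variable P : metric_pair.
Local Notation A := (mp_set P).

Definition d1 (x y : X) : R :=
  Num.min (mdist x y) (dist_to A x + dist_to A y).

Lemma dist_to_ge0 x : 0 <= dist_to A x.
Proof.
apply: lb_le_inf => [|_ [a _ <-]]; last exact: mdist_ge0.
exact/image_nonempty/mp_nonempty.
Qed.

Lemma dist_to_le x a : A a -> dist_to A x <= mdist x a.
Proof.
move=> Aa; apply: ge_inf; last by exists a.
by exists 0 => _ [b _ <-]; exact: mdist_ge0.
Qed.

Lemma dist_to0 a : A a -> dist_to A a = 0.
Proof.
move=> Aa; apply/eqP; rewrite eq_le dist_to_ge0 andbT.
by rewrite (le_trans (dist_to_le _ Aa))// mdistxx.
Qed.

Lemma dist_to_triangle x y : dist_to A x <= mdist x y + dist_to A y.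
Proof.
rewrite -lerBlDl; apply: lb_le_inf.
  exact/image_nonempty/mp_nonempty.
move=> _ [a Aa <-]; rewrite lerBlDl.
by rewrite (le_trans (dist_to_le x Aa))// metric_triangle.
Qed.

Lemma d1_ge0 x y : 0 <= d1 x y.
Proof. by rewrite le_min mdist_ge0 addr_ge0 ?dist_to_ge0. Qed.

Lemma d1_sym x y : d1 x y = d1 y x.
Proof. by rewrite /d1 metric_sym (addrC (dist_to A x)). Qed.

Lemma d1_triangle y x z : d1 x z <= d1 x y + d1 y z.
Proof.
have := metric_triangle x y z.
have := dist_to_triangle x y; have := dist_to_triangle z y.
rewrite (metric_sym z y) => h1 h2 h3.
have := dist_to_ge0 y => h4.
rewrite /d1; case: (leP (mdist x y)) => _; case: (leP (mdist y z)) => _;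
  rewrite ge_min; apply/orP; [left|right|right|right]; lra.
Qed.

Definition collapse_rel (x y : X) : bool := `[< x = y \/ A x /\ A y >].

Lemma collapse_rel_refl : reflexive collapse_rel.
Proof. by move=> x; apply/asboolP; left. Qed.

Lemma collapse_rel_sym : symmetric collapse_rel.
Proof. by move=> x y; apply/asboolP/asboolP => -[->|[? ?]]; by [left|right]. Qed.

Lemma collapse_rel_trans : transitive collapse_rel.
Proof.
move=> y x z /asboolP xy /asboolP yz; apply/asboolP.
by case: xy => [->//|[Ax Ay]]; case: yz => [<-|[_ Az]]; right.
Qed.

Canonical collapse_equiv :=
  EquivRel collapse_rel collapse_rel_refl collapse_rel_sym collapse_rel_trans.

Definition quot_space := {eq_quot collapse_equiv}.

HB.instance Definition _ := Choice.on quot_space.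
HB.instance Definition _ : EqQuotient _ collapse_equiv quot_space :=
  EqQuotient.on quot_space.

Lemma quot_spaceP (x y : X) :
  \pi_quot_space x = \pi_quot_space y <-> x = y \/ A x /\ A y.
Proof.
split => [/eqquotP/asboolP//|H]; exact/eqquotP/asboolP.
Qed.

Lemma d1_eq0 x y : d1 x y = 0 -> x = y \/ A x /\ A y.
Proof.
rewrite /d1; case: (leP (mdist x y)) => _.
  by move/mdist_positivity; left.
move=> /eqP; rewrite paddr_eq0 ?dist_to_ge0// => /andP[/eqP x0 /eqP y0]; right.
by split; apply: contrapT => /mp_dist_gt0; rewrite ?x0 ?y0 ltxx.
Qed.

Lemma d1xx x : d1 x x = 0.
Proof.
by apply/eqP; rewrite eq_le d1_ge0 andbT ge_min mdistxx lexx.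
Qed.

Lemma d1_subset a b : A a -> A b -> d1 a b = 0.
Proof.
by move=> Aa Ab; rewrite /d1 !dist_to0// addr0 min_r// mdist_ge0.
Qed.

Definition quot_dist (u v : quot_space) : R := d1 (repr u) (repr v).

Lemma d1_repr x y :
  quot_dist (\pi_quot_space x) (\pi_quot_space y) = d1 x y.
Proof.
have r0 z : d1 (repr (\pi_quot_space z)) z = 0.
  have /quot_spaceP[->|[]] : \pi_quot_space (repr (\pi_quot_space z)) =
    \pi_quot_space z by rewrite reprK.
  - exact: d1xx.
  - exact: d1_subset.
apply/eqP; rewrite eq_le; apply/andP; split.
- rewrite (le_trans (d1_triangle x _ _))// r0 add0r.
  by rewrite (le_trans (d1_triangle y _ _))// (d1_sym y) r0 addr0.
- rewrite (le_trans (d1_triangle (repr (\pi_quot_space x)) _ _))//.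
  rewrite (d1_sym x) r0 add0r.
  by rewrite (le_trans (d1_triangle (repr (\pi_quot_space y)) _ _))// r0 addr0.
Qed.

Lemma quot_distxx u : quot_dist u u = 0.
Proof. exact: d1xx. Qed.

Lemma quot_dist_positivity u v : quot_dist u v = 0 -> u = v.
Proof. by move=> /d1_eq0/quot_spaceP; rewrite !reprK. Qed.

Lemma quot_dist_sym u v : quot_dist u v = quot_dist v u.
Proof. exact: d1_sym. Qed.

Lemma quot_dist_triangle v u w :
  quot_dist u w <= quot_dist u v + quot_dist v w.
Proof. exact: d1_triangle. Qed.

HB.instance Definition _ := @isMetric.Build R quot_space quot_dist
  quot_distxx quot_dist_positivity quot_dist_sym quot_dist_triangle.

Lemma mdist_piE x y :
  mdist (\pi_quot_space x : quot_space) (\pi_quot_space y) = d1 x y.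
Proof. exact: d1_repr. Qed.

Definition quot_base : quot_space := \pi_quot_space (projT1 (cid (mp_nonempty P))).

Lemma quot_baseP x : \pi_quot_space x = quot_base <-> A x.
Proof.
rewrite /quot_base; case: cid => a /= Aa; rewrite quot_spaceP.
by split => [[->|[]]|]//; right.
Qed.

End MetricPair.

Arguments quot_base {R X} P.

Definition separable (T : topologicalType) : Prop :=
  exists2 C : set T, countable C & dense C.

Definition uniformly_discrete (R : realType) (T : metricType R) : Prop :=
  exists2 e : R, 0 < e & forall u v : T, u != v -> e <= mdist u v.

Section Grothendieck.
Variable M : nmodType.
Implicit Types (p q : M * M).

Definition groth_rel p q : bool :=
  `[< exists c, p.1 + q.2 + c = q.1 + p.2 + c >].

Lemma groth_rel_refl : reflexive groth_rel.
Proof. by move=> p; apply/asboolP; exists 0. Qed.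

Lemma groth_rel_sym : symmetric groth_rel.
Proof. by move=> p q; apply/asboolP/asboolP => -[c e]; exists c. Qed.

Lemma groth_rel_trans : transitive groth_rel.
Proof.
move=> q p r /asboolP[c e] /asboolP[c' e'].
apply/asboolP; exists (q.1 + q.2 + c + c').
rewrite [LHS](AC (2*4) ((1*4*5)*(3*2*6)))/= e e'.
by rewrite [LHS](AC (3*3) ((4*2)*(1*5*3*6))).
Qed.

Canonical groth_equiv :=
  EquivRel groth_rel groth_rel_refl groth_rel_sym groth_rel_trans.

Definition grothendieck := {eq_quot groth_equiv}.

HB.instance Definition _ := Choice.on grothendieck.
HB.instance Definition _ : EqQuotient _ groth_equiv grothendieck :=
  EqQuotient.on grothendieck.

Definition gdiff (a b : M) : grothendieck := \pi_grothendieck (a, b).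

Lemma gdiffP a b a' b' :
  gdiff a b = gdiff a' b' <-> exists c, a + b' + c = a' + b + c.
Proof.
split => [/eqquotP/asboolP//|H]; exact/eqquotP/asboolP.
Qed.

Lemma gdiff_repr (g : grothendieck) : gdiff (repr g).1 (repr g).2 = g.
Proof. by rewrite /gdiff -surjective_pairing reprK. Qed.

Definition groth_add (g h : grothendieck) :=
  gdiff ((repr g).1 + (repr h).1) ((repr g).2 + (repr h).2).
Definition groth_opp (g : grothendieck) := gdiff (repr g).2 (repr g).1.

Lemma groth_addE a b a' b' :
  groth_add (gdiff a b) (gdiff a' b') = gdiff (a + a') (b + b').
Proof.
have /gdiffP[c e] := gdiff_repr (gdiff a b).
have /gdiffP[c' e'] := gdiff_repr (gdiff a' b').
apply/gdiffP; exists (c + c').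
rewrite [LHS](AC (2*2*2) ((1*3*5)*(2*4*6)))/= e e'.
by rewrite [LHS](AC (3*3) ((1*4)*(2*5)*(3*6))).
Qed.

Lemma groth_oppE a b : groth_opp (gdiff a b) = gdiff b a.
Proof.
have /gdiffP[c e] := gdiff_repr (gdiff a b).
by apply/gdiffP; exists c; rewrite (addrC _ a) -e (addrC b).
Qed.

Lemma groth_addA : associative groth_add.
Proof.
move=> g h k; rewrite -(gdiff_repr g) -(gdiff_repr h) -(gdiff_repr k).
by rewrite !groth_addE !addrA.
Qed.

Lemma groth_addC : commutative groth_add.
Proof.
move=> g h; rewrite -(gdiff_repr g) -(gdiff_repr h) !groth_addE.
by congr gdiff; exact: addrC.
Qed.

Lemma groth_add0 : left_id (gdiff 0 0) groth_add.
Proof. by move=> g; rewrite -(gdiff_repr g) groth_addE !add0r. Qed.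

Lemma groth_addN : left_inverse (gdiff 0 0) groth_opp groth_add.
Proof.
move=> g; rewrite -(gdiff_repr g) groth_oppE groth_addE; apply/gdiffP.
by exists 0; rewrite !addr0 !add0r addrC.
Qed.

HB.instance Definition _ := GRing.isZmodule.Build grothendieck
  groth_addA groth_addC groth_add0 groth_addN.

End Grothendieck.

(* The monoid D(X,A) = D(X)/D(A), D(Y) being the finite multisets in Y *)

Section Diagrams.
Variables (R : realType) (X : metricType R) (P : metric_pair X).
Local Notation A := (mp_set P).
Implicit Types (a b : {mset X}).

Definition mset_on (B : set X) a : Prop := forall x, x \in a -> B x.

Definition diag_rel a b : bool :=
  `[< exists a' b', [/\ mset_on A a', mset_on A b' & a `+` a' = b `+` b'] >].

Lemma mset_onD (B : set X) a b :
  mset_on B a -> mset_on B b -> mset_on B (a `+` b).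
Proof. by move=> ha hb x; rewrite in_msetD => /orP[/ha|/hb]. Qed.

Lemma diag_rel_refl : reflexive diag_rel.
Proof.
by move=> a; apply/asboolP; exists mset0, mset0; split => // x; rewrite in_mset0.
Qed.

Lemma diag_rel_sym : symmetric diag_rel.
Proof.
by move=> a b; apply/asboolP/asboolP => -[a' [b' [? ? e]]]; exists b', a'; split.
Qed.

Lemma diag_rel_trans : transitive diag_rel.
Proof.
move=> b a c /asboolP[a1 [b1 [ha1 hb1 e]]] /asboolP[b2 [c2 [hb2 hc2 e']]].
apply/asboolP; exists (a1 `+` b2), (c2 `+` b1); split; try exact: mset_onD.
by rewrite msetDA e msetDAC e' msetDA.
Qed.

Canonical diag_equiv :=
  EquivRel diag_rel diag_rel_refl diag_rel_sym diag_rel_trans.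

Definition diagrams := {eq_quot diag_equiv}.

HB.instance Definition _ := Choice.on diagrams.
HB.instance Definition _ : EqQuotient _ diag_equiv diagrams :=
  EqQuotient.on diagrams.

Definition diag a : diagrams := \pi_diagrams a.

Lemma diagP a b : diag a = diag b <->
  exists a' b', [/\ mset_on A a', mset_on A b' & a `+` a' = b `+` b'].
Proof.
split => [/eqquotP/asboolP//|H]; exact/eqquotP/asboolP.
Qed.

Lemma diag_repr (s : diagrams) : diag (repr s) = s.
Proof. exact: reprK. Qed.

Definition diag_add (s t : diagrams) := diag (repr s `+` repr t).

Lemma diag_addE a b : diag_add (diag a) (diag b) = diag (a `+` b).
Proof.
have /diagP[a' [a2 [ha ha2 e]]] := diag_repr (diag a).
have /diagP[b' [b2 [hb hb2 e']]] := diag_repr (diag b).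
apply/diagP; exists (a' `+` b'), (a2 `+` b2); split; try exact: mset_onD.
by rewrite msetDACA e e' msetDACA.
Qed.

Lemma diag_addA : associative diag_add.
Proof.
move=> s t u; rewrite -(diag_repr s) -(diag_repr t) -(diag_repr u).
by rewrite !diag_addE msetDA.
Qed.

Lemma diag_addC : commutative diag_add.
Proof. by move=> s t; rewrite /diag_add msetDC. Qed.

Lemma diag_add0 : left_id (diag mset0) diag_add.
Proof. by move=> s; rewrite -(diag_repr s) diag_addE mset0D. Qed.

HB.instance Definition _ := GRing.isNmodule.Build diagrams
  diag_addA diag_addC diag_add0.

Definition coupling (s t : diagrams) (sigma : {mset X * X}) : Prop :=
  diag (seq_mset [seq p.1 | p <- sigma]) = s /\
  diag (seq_mset [seq p.2 | p <- sigma]) = t.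

Definition W1 (s t : diagrams) : R :=
  inf [set \sum_(p <- sigma) d1 P p.1 p.2 | sigma in coupling s t].

Definition vgroup := grothendieck diagrams.

HB.instance Definition _ := GRing.Zmodule.on vgroup.

(* The value does not depend on the chosen differences, by translation
   invariance of W1. *)
Definition rho (g h : vgroup) : R :=
  let: (a, b) := repr g in let: (c, d) := repr h in W1 (a + d) (c + b).

(* The space V(X,A), in its basis indexed by the points of X/A other than [A] *)

Definition free_basis := {u : quot_space P | u != quot_base P}.

Definition free_space := {freeg free_basis / R}.

HB.instance Definition _ := GRing.Lmodule.on free_space.

Definition lip1_based (f : quot_space P -> R) : Prop :=
  f (quot_base P) = 0 /\ forall u v, `|f u - f v| <= mdist u v.

(* fglift f v is \sum_u c_u f(u) for v = \sum_u c_u e_u *)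
Definition W1_norm (v : free_space) : R :=
  sup [set fglift (fun u : free_basis => f (val u) : R^o) v
      | f in lip1_based].

(* The class in V(X,A) of a point of X, which vanishes on A *)
Definition free_point (x : X) : free_space :=
  if insub (\pi_(quot_space P) x) is Some u then << u >> else 0.

Definition diag_free (s : diagrams) : free_space :=
  \sum_(x <- repr s) free_point x.

Definition vgroup_free (g : vgroup) : free_space :=
  diag_free (repr g).1 - diag_free (repr g).2.

Lemma free_point0 x : A x -> free_point x = 0.
Proof. by move=> /quot_baseP Ax; rewrite /free_point insubF// Ax eqxx. Qed.


Lemma big_msetD (V : nmodType) (F : X -> V) a b :
  \sum_(x <- a `+` b) F x = \sum_(x <- a) F x + \sum_(x <- b) F x.
Proof.
rewrite -big_cat; apply: perm_big; apply/allP => x _ /=.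
by rewrite count_cat !count_mem_mset msetE2.
Qed.

Lemma diag_freeE a : diag_free (diag a) = \sum_(x <- a) free_point x.
Proof.
have /diagP[a' [b' [ha hb e]]] := diag_repr (diag a).
have sum0 c : mset_on A c -> \sum_(x <- c) free_point x = 0.
  by move=> hc; rewrite big_seq big1// => x /hc/free_point0.
have := big_msetD free_point (repr (diag a)) a'.
by rewrite e big_msetD (sum0 _ ha) (sum0 _ hb) !addr0.
Qed.

Lemma diag_freeD s t : diag_free (s + t) = diag_free s + diag_free t.
Proof.
rewrite -(diag_repr s) -(diag_repr t) [_ + _]diag_addE !diag_freeE.
exact: big_msetD.
Qed.

Lemma diag_free_inj : injective diag_free.
Proof.
move=> s t; rewrite -(diag_repr s) -(diag_repr t).
move: (repr s) (repr t) => a b; rewrite !diag_freeE => e.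
have coefE (x : X) (u : free_basis) (c : {mset X}) : ~ A x ->
    val u = \pi_(quot_space P) x ->
    coeff u (\sum_(y <- c) free_point y) = (c x)%:R.
  move=> Ax ux; rewrite raddf_sum /= -(count_mem_mset x c) -sum1_count.
  rewrite natr_sum [RHS]big_mkcond/=; apply: eq_bigr => y _; rewrite eq_sym.
  rewrite /free_point; case: insubP => [v _ vy|/negbNE/eqP/quot_baseP Ay].
    rewrite coeffU mul1r -val_eqE vy ux.
    have [->|xy] := eqVneq x y; first by rewrite eqxx.
    case: eqP => // /quot_spaceP[yx|[_ /Ax//]].
    by move: xy; rewrite yx eqxx.
  by rewrite coeff0; case: eqP => // xy; move: Ax; rewrite xy.
have ab x : ~ A x -> a x = b x.
  move=> Ax; have ux : \pi_(quot_space P) x != quot_base P.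
    by apply/eqP => /quot_baseP.
  have := congr1 (coeff (Sub (\pi_(quot_space P) x) ux)) e.
  by rewrite !(coefE x)// => /eqP; rewrite eqr_nat => /eqP.
pose AI (c : {mset X}) := seq_mset [seq x <- c | x \in A].
have AIE (c : {mset X}) x : AI c x = if x \in A then c x else 0%N.
  rewrite mset_seqE; case: ifPn => xA.
    by rewrite count_filter -count_mem_mset; apply: eq_count => y /=;
      case: eqP => // ->; rewrite xA.
  by apply/count_memPn; rewrite mem_filter (negbTE xA).
have AI_on c : mset_on A (AI c).
  move=> x; rewrite -msuppE mem_finsupp AIE; case: ifPn => // xA _.
  by rewrite inE in xA.
apply/diagP; exists (AI b), (AI a); split => //.
apply/msetP => x; rewrite !msetE2 !AIE; case: ifPn => [_|/negP xA].
  exact: addnC.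
by rewrite ab//; move: xA; rewrite inE.
Qed.

Lemma vgroup_freeE s t : vgroup_free (gdiff s t) = diag_free s - diag_free t.
Proof.
have /gdiffP[c] := gdiff_repr (gdiff s t).
move/(congr1 diag_free); rewrite !diag_freeD => /addIr e.
by apply/eqP; rewrite subr_eq addrAC -subr_eq opprK e addrC.
Qed.

Lemma vgroup_free_zmod_morphism : zmod_morphism vgroup_free.
Proof.
move=> g h; rewrite -(gdiff_repr g) -(gdiff_repr h).
rewrite [- _]groth_oppE [_ + _]groth_addE !vgroup_freeE !diag_freeD.
by rewrite opprB opprD addrACA.
Qed.

HB.instance Definition _ :=
  GRing.isZmodMorphism.Build vgroup free_space vgroup_free
    vgroup_free_zmod_morphism.

Lemma vgroup_free_inj : injective vgroup_free.
Proof.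
apply: raddf_inj => g; rewrite -(gdiff_repr g) /= vgroup_freeE => /subr0_eq.
by move/diag_free_inj ->; apply/gdiffP; exists 0; rewrite !addr0 !add0r.
Qed.

(* The supremum is taken in [0, +oo], hence is 0 over an empty family. *)
Definition lip_rho (f : vgroup -> R) : \bar R :=
  maxe 0%E (ereal_sup [set (`|f p.1 - f p.2| / rho p.1 p.2)%:E
                      | p in [set p : vgroup * vgroup | p.1 <> p.2]]).

End Diagrams.

Section Completion.
Variables (R : realType) (V : lmodType R) (nrm : V -> R).

(* Unique up to a unique isometric isomorphism compatible with the inclusion. *)
Record banach_completion := BanachCompletion {
  completion_space :> completeNormedModType R ;
  completion_incl : {linear V -> completion_space} ;
  completion_norm : forall v, `|completion_incl v| = nrm v ;
  completion_dense : dense (range completion_incl)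
}.

End Completion.

Definition vgroup_embed (R : realType) (X : metricType R) (P : metric_pair X)
    (B : banach_completion (@W1_norm R X P)) (g : vgroup P) : B :=
  completion_incl B (vgroup_free g).

Section SquareSummable.
Variable R : realType.
Implicit Types (u s : R^nat).

Definition square_summable u : Prop := finite_norm counting 2%:E u.

Definition l2_norm u : R := fine ('N[counting]_2%:E [EFin \o u])%E.

(* the operator of l^2 with e_n as eigenvector of eigenvalue s n *)
Definition diag_op s u : R^nat := fun n => s n * u n.

Lemma diag_op_sqrt s u : (forall n, 0 <= s n) ->
  diag_op (Num.sqrt \o s) (diag_op (Num.sqrt \o s) u) = diag_op s u.
Proof.
by move=> s0; apply/funext => n; rewrite /diag_op/= mulrA -expr2 sqr_sqrtr.
Qed.

End SquareSummable.

Section Covariance.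
Variables (R : realType) (B : completeNormedModType R).

Definition dual_norm (l : B -> R) : \bar R :=
  ereal_sup [set `|l x|%:E | x in [set x : B | `|x| <= 1]].

(* Sequences are indexed from 0. *)
Record covariance_data := CovarianceData {
  cov_ell : nat -> {linear B -> R^o} ;
  cov_w : R^nat ;
  cov_sigma : R^nat ;
  cov_ell_continuous : forall n, continuous (cov_ell n) ;
  cov_ell_le1 : forall n, (dual_norm (cov_ell n) <= 1)%E ;
  cov_ell_norming : forall x : B,
    (`|x|%:E = ereal_sup (range (fun n => `|cov_ell n x|%:E)))%E ;
  cov_w_gt0 : forall n, 0 < cov_w n ;
  cov_w_l2 : square_summable cov_w ;
  cov_sigma_ge0 : forall n, 0 <= cov_sigma n ;
  cov_sigma_summable : cvgn (series cov_sigma)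
}.

Variable D : covariance_data.

Definition cov_J (x : B) : R^nat := fun n => cov_w D n * cov_ell D n x.

Definition cov_Sigma : R^nat -> R^nat := diag_op (cov_sigma D).

Definition cov_sqrt_Sigma : R^nat -> R^nat :=
  diag_op (Num.sqrt \o cov_sigma D).

Lemma cov_sqrt_SigmaK u : cov_sqrt_Sigma (cov_sqrt_Sigma u) = cov_Sigma u.
Proof. by apply: diag_op_sqrt; exact: cov_sigma_ge0. Qed.

Definition cov_kernel (t : R) (x y : B) : R :=
  expR (- (t / 2) * l2_norm (cov_sqrt_Sigma (cov_J (x - y))) ^+ 2).

End Covariance.

Section RKHS.
Variables (R : realType) (T : Type) (k : T -> T -> R).

(* The Hilbert space of functions on T with reproducing kernel k; an element f
   is identified with the function rkhs_fun f. It is unique for given k. *)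
Record rkhs := Rkhs {
  rkhs_space :> completeNormedModType R ;
  rkhs_dot : {dot rkhs_space for idfun} ;
  rkhs_dotE : forall f, rkhs_dot f f = `|f| ^+ 2 ;
  rkhs_fun : {linear rkhs_space -> (T -> R^o)} ;
  rkhs_fun_inj : injective rkhs_fun ;
  rkhs_section : T -> rkhs_space ;
  rkhs_sectionE : forall x, rkhs_fun (rkhs_section x) = k ^~ x ;
  rkhs_reproducing : forall f x, rkhs_fun f x = rkhs_dot f (rkhs_section x)
}.

End RKHS.

(* Main.v *)
From HB Require Import structures.
Require Import Defs.
From mathcomp Require Import all_boot all_order all_algebra.
From mathcomp Require Import generic_quotient finmap multiset.
From mathcomp Require Import all_classical all_reals all_analysis.
From mathcomp Require Import freeg lra ring.

(** A function f of the reproducing kernel Hilbert space is evaluated by pairing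
with the sections of the kernel, so by Cauchy-Schwarz
|f x - f y| <= |f| |k_x - k_y|, where |k_x - k_y|^2 = k x x - 2 k x y + k y y
([rkhs_increment_le]). For the Gaussian kernel this square is
2 - 2 exp (- t q / 2) <= t q, with q = |Sigma^(1/2) J (x - y)|^2. As the
functionals ell_n are bounded by the norm,
q = \sum_n sigma_n w_n^2 ell_n (x - y)^2 <= (\sum_n sigma_n w_n^2) |x - y|^2
([cov_form_le]). Hence f is Lipschitz on the whole Banach space for the norm
distance, with the constant of the theorem ([cov_rkhs_lipschitz]).

To restrict this to K(X,A), only the easy half of Kantorovich duality is
needed: rho dominates the norm distance ([vgroup_embed_dist_le]), because every
based 1-Lipschitz function integrates against a coupling to at most its cost. *)

Set Implicit Arguments.
Unset Strict Implicit.
Unset Printing Implicit Defensive.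

Import Order.TTheory GRing.Theory Num.Theory.
Import numFieldNormedType.Exports.
Local Open Scope classical_set_scope.
Local Open Scope ring_scope.

(** * Cauchy-Schwarz for a real scalar product *)

Section DotProduct.
Variables (R : realType) (V : lmodType R) (dot : {dot V for (@idfun R)}).

Lemma dotC u v : dot u v = dot v u.
Proof. by rewrite hermitian_subproof expr0 mul1r. Qed.

Lemma dot_ge0 u : 0 <= dot u u.
Proof.
have [->|u0] := eqVneq u 0; first by rewrite linear0r.
exact/ltW/neq0_dnorm_gt0.
Qed.

Lemma dot_subZ a u v :
  dot (u - a *: v) (u - a *: v) = dot u u - 2 * a * dot u v + a ^+ 2 * dot v v.
Proof.
rewrite linearBl !linearBr linearZl_LR !linearZ_LR/= linearZl_LR/= (dotC v u).
rewrite /GRing.scale/= expr2; lra.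
Qed.

(** The vector u minus its projection on v has nonnegative square. *)
Lemma dot_Cauchy_Schwarz u v : dot u v ^+ 2 <= dot u u * dot v v.
Proof.
have [->|v0] := eqVneq v 0; first by rewrite !linear0r expr0n.
have vv := neq0_dnorm_gt0 (s := dot) v v0.
have := dot_ge0 (u - (dot u v / dot v v) *: v); rewrite dot_subZ.
move/(mulr_ge0 (ltW vv)); rewrite -subr_ge0; congr (0 <= _).
by field; rewrite gt_eqF.
Qed.

End DotProduct.

(** * Increments of functions in a reproducing kernel Hilbert space *)

Section RKHS.
Variables (R : realType) (T : Type) (k : T -> T -> R) (H : rkhs k).
Local Notation dot := (rkhs_dot H).

Lemma rkhs_kernelE x y : dot (rkhs_section H x) (rkhs_section H y) = k y x.
Proof. by rewrite -rkhs_reproducing rkhs_sectionE. Qed.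

Lemma rkhs_increment_le (f : H) x y :
  `|rkhs_fun H f x - rkhs_fun H f y| <=
  `|f| * Num.sqrt (k x x - 2 * k x y + k y y).
Proof.
rewrite !rkhs_reproducing -linearBr.
have -> : k x x - 2 * k x y + k y y =
    dot (rkhs_section H x - rkhs_section H y)
        (rkhs_section H x - rkhs_section H y).
  have := dot_subZ (rkhs_dot H) 1 (rkhs_section H x) (rkhs_section H y).
  rewrite scale1r => ->; rewrite mulr1 expr1n mul1r -!rkhs_kernelE.
  by rewrite (dotC dot (rkhs_section H y)).
rewrite -sqrtr_sqr -[in leRHS](normr_id f) -[in leRHS]sqrtr_sqr.
rewrite -sqrtrM ?sqr_ge0// -rkhs_dotE ler_wsqrtr//.
exact: dot_Cauchy_Schwarz.
Qed.

End RKHS.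

(** * The norm of l^2 as a series *)

Section SquareSummable.
Variable R : realType.
Implicit Types u v : R^nat.

Lemma Lnorm2_counting u :
  ('N[counting]_2%:E [EFin \o u] =
   (\sum_(0 <= n <oo) (u n ^+ 2)%:E) `^ 2^-1)%E.
Proof.
rewrite Lnorm_counting//; congr (limn _ `^ _)%E; apply/funext => n.
apply: eq_bigr => i _ /=.
by rewrite powR_mulrn// real_normK// num_real.
Qed.

Lemma l2_norm_sqr u :
  l2_norm u ^+ 2 = fine (\sum_(0 <= n <oo) (u n ^+ 2)%:E)%E.
Proof.
have u0 : 0 <= fine (\sum_(0 <= n <oo) (u n ^+ 2)%:E)%E.
  by apply/fine_ge0/nneseries_ge0 => n _ _; rewrite lee_fin sqr_ge0.
by rewrite /l2_norm Lnorm2_counting fine_poweR powR12_sqrt// sqr_sqrtr.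
Qed.

Lemma square_summable_bounded u n :
  square_summable u -> u n ^+ 2 <= l2_norm u ^+ 2.
Proof.
have u0 m : (0 <= (u m ^+ 2)%:E)%E by rewrite lee_fin sqr_ge0.
rewrite /square_summable /finite_norm Lnorm2_counting => /lty_poweRy uoo.
rewrite l2_norm_sqr -lee_fin fineK; last first.
  rewrite ge0_fin_numE ?uoo ?invr_neq0//.
  exact: nneseries_ge0.
apply: le_trans (@nneseries_lim_ge _ _ xpredT 0 n.+1 _) => //.
by rewrite big_nat_recr//= leeDr// sume_ge0.
Qed.

(** The sum of the squares converges by comparison with v, so that the norm is
finite and its real part is the norm itself. *)
Lemma l2_norm_sqr_le u v :
  (forall n, u n ^+ 2 <= v n) -> cvgn (series v) ->
  l2_norm u ^+ 2 <= limn (series v).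
Proof.
move=> uv cv.
have cu : cvgn (series (fun n => u n ^+ 2)).
  apply: series_le_cvg cv => // n; first exact: sqr_ge0.
  by rewrite (le_trans _ (uv n))// sqr_ge0.
rewrite l2_norm_sqr (_ : limn _ = (limn (series (fun n => u n ^+ 2)))%:E).
  exact: lim_series_le.
rewrite -EFin_lim//; congr (limn _); apply/funext => n /=.
by rewrite sumEFin.
Qed.

End SquareSummable.
(** * The Gaussian kernel of admissible covariance data *)

Section Covariance.
Variables (R : realType) (B : completeNormedModType R) (D : covariance_data B).

(** The trace of the operator Sigma diag(w)^2 on l^2; it bounds the square of
the operator norm of Sigma^(1/2) J. *)
Definition cov_trace : R :=
  limn (series (fun n => cov_sigma D n * cov_w D n ^+ 2)).

(** A square-summable sequence of weights is bounded, and sigma is summable. *)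
Lemma cov_trace_cvg : cvgn (series (fun n => cov_sigma D n * cov_w D n ^+ 2)).
Proof.
have s0 n := cov_sigma_ge0 D n; pose M := l2_norm (cov_w D) ^+ 2.
apply: (@series_le_cvg _ _ (fun n => M * cov_sigma D n)) => [n|n|n|].
- by rewrite mulr_ge0// sqr_ge0.
- by rewrite mulr_ge0// sqr_ge0.
- by rewrite mulrC ler_wpM2r//; apply: square_summable_bounded (cov_w_l2 D).
- exact/is_cvg_seriesZ/cov_sigma_summable.
Qed.

Lemma cov_trace_ge0 : 0 <= cov_trace.
Proof.
apply: limr_ge; first exact: cov_trace_cvg.
by apply: nearW => n; apply: sumr_ge0 => i _;
  exact/mulr_ge0/sqr_ge0/cov_sigma_ge0.
Qed.

(** |x| is the supremum of the |ell_n x|. *)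
Lemma cov_ell_le n x : `|cov_ell D n x| <= `|x|.
Proof.
by rewrite -lee_fin (cov_ell_norming D x); apply: ereal_sup_ubound; exists n.
Qed.

Lemma cov_form_le x :
  l2_norm (cov_sqrt_Sigma D (cov_J D x)) ^+ 2 <= cov_trace * `|x| ^+ 2.
Proof.
rewrite /cov_trace mulrC.
have cv := cov_trace_cvg.
have := lim_seriesZ (`|x| ^+ 2) cv; rewrite /GRing.scale/= => <-.
apply: l2_norm_sqr_le => [n|]; last exact: is_cvg_seriesZ.
rewrite /cov_sqrt_Sigma /diag_op /cov_J/= !exprMn.
rewrite sqr_sqrtr ?cov_sigma_ge0// [leLHS]mulrA [leRHS]mulrC.
apply: ler_wpM2l; first exact/mulr_ge0/sqr_ge0/cov_sigma_ge0.
by rewrite -real_normK ?num_real// ler_sqr ?nnegrE// cov_ell_le.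
Qed.

Variable t : R.
Hypothesis t_ge0 : 0 <= t.

Lemma cov_kernel_le1 x y : cov_kernel D t x y <= 1.
Proof.
rewrite /cov_kernel expR_le1 mulNr oppr_le0.
by rewrite mulr_ge0 ?sqr_ge0 ?divr_ge0.
Qed.

(** The convexity bound 1 + a <= exp a linearizes the Gaussian. *)
Lemma cov_kernel_ge x y :
  1 - t / 2 * (cov_trace * `|x - y| ^+ 2) <= cov_kernel D t x y.
Proof.
apply: le_trans (expR_ge1Dx _); rewrite lerD2l mulNr lerN2.
by rewrite ler_wpM2l ?divr_ge0// cov_form_le.
Qed.

Lemma cov_rkhs_lipschitz (H : rkhs (cov_kernel D t)) (f : H) x y :
  `|rkhs_fun H f x - rkhs_fun H f y| <=
  Num.sqrt t * Num.sqrt cov_trace * `|f| * `|x - y|.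
Proof.
apply: le_trans (rkhs_increment_le f x y) _.
have k_le : cov_kernel D t x x - 2 * cov_kernel D t x y + cov_kernel D t y y <=
    t * (cov_trace * `|x - y| ^+ 2).
  have := cov_kernel_ge x y; have := cov_kernel_le1 x x.
  have := cov_kernel_le1 y y; lra.
rewrite [leRHS]mulrAC [leRHS]mulrC ler_wpM2l//.
apply: le_trans (ler_wsqrtr k_le) _.
rewrite sqrtrM// -mulrA ler_wpM2l ?sqrtr_ge0// sqrtrM ?cov_trace_ge0//.
by rewrite sqrtr_sqr normr_id.
Qed.

End Covariance.

(** * The transport distance dominates the norm distance *)

Section Transport.
Variables (R : realType) (X : metricType R) (P : metric_pair X).
Local Notation A := (mp_set P).
Implicit Types (s t : diagrams P) (g h : vgroup P).

Lemma big_seq_mset (T : choiceType) (V : nmodType) (F : T -> V) (r : seq T) :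
  \sum_(x <- seq_mset r) F x = \sum_(x <- r) F x.
Proof. exact/perm_big/perm_eq_seq_mset. Qed.

Lemma coupling_diag_free s t sigma : coupling s t sigma ->
  diag_free s = \sum_(p <- sigma) free_point P p.1 /\
  diag_free t = \sum_(p <- sigma) free_point P p.2.
Proof. by case=> <- <-; rewrite !diag_freeE !big_seq_mset !big_map. Qed.

(** Send all the mass of s to a point of A and bring that of t from there: mass
on A is not counted. This keeps the infimum that defines W1 from ranging over
the empty set, where it would be 0. *)
Lemma coupling_exists s t : coupling s t !=set0.
Proof.
have [a Aa] := mp_nonempty P.
exists (seq_mset ([seq (x, a) | x <- repr s] ++ [seq (a, y) | y <- repr t])).
have a0 (r : seq X) : \sum_(x <- r) free_point P a = 0.
  by rewrite big1// => x _; exact: free_point0.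
split; apply: diag_free_inj;
  rewrite diag_freeE big_seq_mset big_map big_seq_mset big_cat/= !big_map/= a0.
- by rewrite addr0.
- by rewrite add0r.
Qed.

Section Lift.
Variable f : quot_space P -> R.
Local Notation lift := (fglift (fun u : free_basis P => f (val u) : R^o)).

HB.instance Definition _ :=
  GRing.isZmodMorphism.Build (free_space P) R lift (lift_is_additive _).

Lemma lift_free_point x : f (quot_base P) = 0 ->
  lift (free_point P x) = f (\pi_(quot_space P) x)%qT.
Proof.
move=> f0; rewrite /free_point; case: insubP => [u _ <-|/negbNE/eqP ->].
  by rewrite liftU scale1r.
by rewrite f0 raddf0.
Qed.

(** Weak Kantorovich duality. *)
Lemma lift_coupling_le s t sigma : lip1_based f -> coupling s t sigma ->
  lift (diag_free s - diag_free t) <= \sum_(p <- sigma) d1 P p.1 p.2.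
Proof.
case=> f0 lipf /coupling_diag_free[-> ->].
rewrite -sumrB raddf_sum; apply: ler_sum => p _.
rewrite raddfB/= !lift_free_point// -mdist_piE.
by rewrite (le_trans (ler_norm _)).
Qed.

End Lift.

Lemma W1_norm_le s t : W1_norm (diag_free s - diag_free t) <= W1 s t.
Proof.
apply: lb_le_inf.
  exact/image_nonempty/coupling_exists.
move=> _ [sigma st <-]; apply: ge_sup.
  apply: image_nonempty; exists (fun=> 0); split=> // u v.
  by rewrite subr0 normr0 mdist_ge0.
by move=> _ [f lipf <-]; exact: lift_coupling_le.
Qed.

Lemma vgroup_embed_dist_le (B : banach_completion (@W1_norm R X P)) g h :
  `|vgroup_embed B g - vgroup_embed B h| <= rho g h.
Proof.
rewrite /vgroup_embed -linearB/= completion_norm -[in leLHS](gdiff_repr g).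
rewrite -[in leLHS](gdiff_repr h) !vgroup_freeE /rho.
case: (repr g) => a b; case: (repr h) => c d /=.
have -> : diag_free a - diag_free b - (diag_free c - diag_free d) =
    diag_free (a + d) - diag_free (c + b).
  by rewrite !diag_freeD opprB opprD; rewrite [LHS](AC (2*2) ((1*3)*(4*2))).
exact: W1_norm_le.
Qed.

End Transport.

Theorem theorem4p4 (R : realType) (X : metricType R) (P : metric_pair X)
    (hsep : separable (quot_space P))
    (hdisc : ~ uniformly_discrete (quot_space P))
    (B : banach_completion (@W1_norm R X P))
    (D : covariance_data B) (t : R) (ht : 0 < t)
    (H : rkhs (cov_kernel D t)) (f : H) :
  (lip_rho (fun g : vgroup P => rkhs_fun H f (vgroup_embed B g)) <=
   (Num.sqrt t *
    Num.sqrt (limn (series (fun n => cov_sigma D n * cov_w D n ^+ 2))) *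
    `|f|)%:E)%E.
Proof.
have C0 : 0 <= Num.sqrt t * Num.sqrt (cov_trace D) * `|f|.
  by rewrite !mulr_ge0.
rewrite /lip_rho ge_max lee_fin C0/=; apply: ge_ereal_sup => _ [[g h] /= _ <-].
have le_rho := vgroup_embed_dist_le B g h.
rewrite lee_fin.
(* If rho g h = 0, the difference quotient is 0, as the inverse of 0 is 0. *)
have := le_trans (normr_ge0 _) le_rho; rewrite le_eqVlt => /predU1P[<-|rho0].
  by rewrite invr0 mulr0.
rewrite ler_pdivrMr//.
apply: le_trans (cov_rkhs_lipschitz (ltW ht) f _ _) _.
by rewrite ler_wpM2l.
Qed.
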